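(* Let $T\in\mathbb{Z}_+$, let $N_T\in\mathbb{R}^{(T+1)q\times(T+1)m}$ be the input-output matrix of a discrete-time linear system $(A,B,C,D)$ (see context), let $\Sigma\in\mathbb{R}^{(T+1)m\times(T+1)m}$ with $\Sigma\succ0$, and let $0<\gamma<1$, $\varepsilon>0$, $0<\delta<1/2$. Assume that $N_T$ has full row rank. Consider the optimization problem over $\Sigma_w\in\mathbb{R}^{(T+1)q\times(T+1)q}$: $$\underset{\Sigma_w\succ0}{\text{minimize}}\ \ \mathrm{Tr}(\Sigma_w)\qquad\text{subject to}\qquad \lambda_{\max}\left(\Sigma^{1/2}N_T^\top\Sigma_w^{-1}N_T\Sigma^{1/2}\right)\le\frac{1}{c(\gamma,T)^2\,\mathsf{R}(\varepsilon,\delta)^2}.$$ Then the optimal solution to this problem is $$\Sigma_w^*:=c(\gamma,T)^2\,\mathsf{R}(\varepsilon,\delta)^2\,N_T\Sigma N_T^\top .$$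
   Context: **System.** Consider $x(t+1)=Ax(t)+Bu(t)$, $y(t)=Cx(t)+Du(t)$, $t\in\mathbb{Z}_+=\{0,1,2,\dots\}$, $x(0)=0$, with $A\in\mathbb{R}^{n\times n}$, $B\in\mathbb{R}^{n\times m}$, $C\in\mathbb{R}^{q\times n}$, $D\in\mathbb{R}^{q\times m}$. With $U_T=[u(0);\dots;u(T)]$ and $Y_T=[y(0);\dots;y(T)]$, one has $Y_T=N_TU_T$, where $N_T$ is the block lower triangular Toeplitz matrix with $(i,j)$ block ($0\le i,j\le T$) equal to $D$ if $i=j$, $CA^{i-j-1}B$ if $i>j$, and $0$ if $i<j$. **Notation.** $c(\gamma,T)$ is the unique $c>0$ that satisfies $$\gamma=\int_0^{c^2/2}\frac{1}{2^{(T+1)m/2}\,\Gamma((T+1)m/2)}\,x^{(T+1)m/2-1}e^{-x/2}\,dx,$$ with $\Gamma$ the gamma function. $\mathsf{Q}(c):=\frac{1}{\sqrt{2\pi}}\int_c^\infty e^{-v^2/2}\,dv$, $\mathsf{Q}^{-1}$ is its inverse function, and $\mathsf{R}(\varepsilon,\delta):=\dfrac{\mathsf{Q}^{-1}(\delta)+\sqrt{(\mathsf{Q}^{-1}(\delta))^2+2\varepsilon}}{2\varepsilon}$. $\succ0$ means (symmetric) positive definite, $\Sigma^{1/2}$ is the principal square root, and $\lambda_{\max}$ is the largest eigenvalue. ($\Sigma$ is the covariance of the Gaussian prior of $U_T$, and $\Sigma_w$ is the covariance of Gaussian noise added to $Y_T$.) *)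

(* Defs.v *)
From HB Require Import structures.
From mathcomp Require Export all_boot all_order all_algebra.
From mathcomp Require Export all_classical all_reals all_analysis.
Export Order.TTheory GRing.Theory Num.Theory numFieldNormedType.Exports.

Set Implicit Arguments.
Unset Strict Implicit.
Unset Printing Implicit Defensive.

Local Open Scope classical_set_scope.
Local Open Scope ring_scope.

Section Matrices.
Context {R : realType}.

Definition posdefmx (n : nat) (M : 'M[R]_n) : Prop :=
  M^T = M /\ forall v : 'cV[R]_n, v != 0 -> 0 < (v^T *m M *m v) 0 0.

Definition possemidefmx (n : nat) (M : 'M[R]_n) : Prop :=
  M^T = M /\ forall v : 'cV[R]_n, 0 <= (v^T *m M *m v) 0 0.

(* Every positive semidefinite matrix has exactly one positive semidefinite
   square root; the default value 0 is only reached outside of that class. *)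
Definition sqrtmx (n : nat) (M : 'M[R]_n) : 'M[R]_n :=
  xget 0 [set S | possemidefmx S /\ S *m S = M].

(* The largest real eigenvalue; 0 by convention if there is none, which does
   not happen for a symmetric matrix of positive size. *)
Definition lambda_max (n : nat) (M : 'M[R]_n) : R :=
  xget 0 [set a | eigenvalue M a /\ forall b, eigenvalue M b -> b <= a].

End Matrices.

Section InputOutputMatrix.
Context {R : realType}.
Variables (n m q : nat).
Variables (A : 'M[R]_n) (B : 'M[R]_(n, m)) (C : 'M[R]_(q, n)) (D : 'M[R]_(q, m)).

Definition io_block (i j : nat) : 'M[R]_(q, m) :=
  if i == j then D
  else if (j < i)%N then C *m A ^+ (i - j - 1) *m B
  else 0.

Lemma size_blocks (T k : nat) : (\sum_(i < T.+1) k = T.+1 * k)%N.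
Proof. by rewrite sum_nat_const card_ord. Qed.

(* The library gives a block matrix the size \sum_(i < T.+1) q by
   \sum_(j < T.+1) m; the cast only renames these sizes. *)
Definition io_matrix (T : nat) : 'M[R]_(T.+1 * q, T.+1 * m) :=
  castmx (size_blocks T q, size_blocks T m)
    (\mxblock_(i < T.+1, j < T.+1) io_block i j).

End InputOutputMatrix.

Section PrivacyConstants.
Context {R : realType}.
Local Notation mu := (@lebesgue_measure R).

Definition Gamma_fun (s : R) : R :=
  \int[mu]_(x in `]0, +oo[) (x `^ (s - 1) * expR (- x)).

Definition chi2_density (k : nat) (x : R) : R :=
  (2 `^ (k%:R / 2) * Gamma_fun (k%:R / 2))^-1
    * x `^ (k%:R / 2 - 1) * expR (- x / 2).

(* The chi-square distribution function with T.+1 * m degrees of freedom is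
   taken at c ^+ 2 / 2, not at c ^+ 2. The defining equation has exactly one
   positive solution when 0 < gamma < 1 and 0 < m. *)
Definition c_const (m : nat) (gamma : R) (T : nat) : R :=
  xget 0 [set c | 0 < c /\
    gamma = \int[mu]_(x in `]0, c ^+ 2 / 2[) chi2_density (T.+1 * m) x].

Definition Q_fun (c : R) : R :=
  (Num.sqrt (2 * pi))^-1 * \int[mu]_(v in `[c, +oo[) expR (- v ^+ 2 / 2).

Definition Q_inv (d : R) : R := xget 0 [set c | Q_fun c = d].

Definition R_fun (eps delta : R) : R :=
  (Q_inv delta + Num.sqrt (Q_inv delta ^+ 2 + 2 * eps)) / (2 * eps).

End PrivacyConstants.

Definition minimizers {R : realType} {X : Type} (f : X -> R) (F : set X) : set X :=
  [set x | F x /\ forall y, F y -> f x <= f y].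

Definition feasible {R : realType} (p r : nat) (N : 'M[R]_(p, r))
    (Sigma : 'M[R]_r) (b : R) : set 'M[R]_p :=
  [set W | posdefmx W /\
    lambda_max (sqrtmx Sigma *m N^T *m invmx W *m N *m sqrtmx Sigma) <= b].

(* Main.v *)
(* Write G = N Sigma N^T = K K^T with K = N Sigma^(1/2).  For W > 0, the bound
   lambda_max (K^T W^-1 K) <= 1/k says x^T K^T W^-1 K x <= |x|^2 / k for all x; at
   x = K^T u, expanding the nonnegative W^-1-form at G u - W u / k turns it into
   k G <= W.  So Tr W >= k Tr G, and a positive semidefinite matrix of trace 0
   vanishes, which forces W = k G in case of equality.  Conversely k G is feasible
   because K^T G^-1 K is a projection.
   That k > 0 requires that the equation defining c(gamma, T) has a solution:
   the chi-square distribution function is continuous and increases from 0 to 1,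
   the total mass being 1 by the substitution x = 2 y in the Gamma integral. *)
Require Import Defs.
From mathcomp Require Import complex lra ring measurable_realfun.

Set Implicit Arguments.
Unset Strict Implicit.
Unset Printing Implicit Defensive.

Local Open Scope classical_set_scope.
Local Open Scope ring_scope.

(** * Symmetric real matrices and the trace minimum *)

(** Newton's scheme: a new node [x] is handled by adding a multiple of the product [g], which
    vanishes at all earlier nodes but not at [x]. It serves to write matrix roots as polynomials in
    the matrix. *)
Lemma poly_interpolation (F : fieldType) (f : F -> F) (rs : seq F) : uniq rs ->
  exists p : {poly F}, {in rs, forall r, p.[r] = f r}.
Proof.
elim: rs => [_|x rs IH /= /andP[xrs /IH[p pE]]]; first by exists 0.
pose g := \prod_(r <- rs) ('X - r%:P).
have gx : g.[x] != 0.
  by rewrite -[_ == _]/(root g x) root_prod_XsubC.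
exists (p + ((f x - p.[x]) / g.[x]) *: g) => r.
rewrite inE hornerD hornerZ => /predU1P[->|rrs]; first by rewrite divfK// subrKC.
have /rootP -> : root g r by rewrite root_prod_XsubC.
by rewrite mulr0 addr0 pE.
Qed.

(** Over the complex numbers [M] is Hermitian, hence unitarily diagonalizable with real spectrum, so
    its minimal polynomial is the product over the distinct eigenvalues. The factorization descends
    to [R] because the embedding is injective on polynomials. *)
Lemma mxminpoly_symmetric (R : realType) n (M : 'M[R]_n.+1) : M^T = M ->
  exists2 rs, uniq rs & mxminpoly M = \prod_(r <- rs) ('X - r%:P).
Proof.
move=> MT.
pose C : numClosedFieldType := complex R.
pose toC : {rmorphism R -> C} := real_complex R.
pose A := map_mx toC M.
have Ah : A \is hermsymmx.
  apply: realsym_hermsym.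
    by apply/is_hermitianmxP; rewrite expr0 scale1r map_mx_id// map_trmx MT.
  apply/mxOverP => i j; rewrite mxE.
  by apply/complex_realP; exists (M i j).
have /hermitian_normalmx /orthomx_spectralP AE := Ah.
have /mxOverP dR := hermitian_spectral_diag_real Ah.
pose d i : R := Re (spectral_diag A 0 i).
have dE i : spectral_diag A 0 i = toC (d i).
  by have /complex_realP[x xE] := dR 0 i; rewrite /d xE.
exists (undup [seq d i | i <- enum 'I_n.+1]); first exact: undup_uniq.
apply: (map_poly_inj toC).
rewrite -mxminpoly_map -/A AE -conjVmx ?spectral_unit//.
rewrite mxminpoly_uconj ?unitmx_inv ?spectral_unit// mxminpoly_diag.
rewrite rmorph_prod/=.
under [RHS]eq_bigr do rewrite rmorphB/= map_polyX map_polyC/=.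
rewrite -(big_map toC xpredT (fun r => 'X - r%:P)) -undup_map_inj; last first.
  exact: complexI.
by rewrite -(map_comp toC d) (eq_map dE).
Qed.

(* A fourth root rather than a square root, so that [Q *m Q] is a square root of [M]
   that is visibly positive semidefinite. *)
Lemma symmetric_fourth_root (R : realType) n (M : 'M[R]_n) : M^T = M ->
  (forall a, eigenvalue M a -> 0 <= a) ->
  exists2 Q : 'M[R]_n, Q^T = Q & Q *m Q *m (Q *m Q) = M.
Proof.
case: n M => [|n] M MT M0; first by exists M => //; rewrite [RHS]flatmx0 flatmx0.
have [rs rsu pE] := mxminpoly_symmetric MT.
have [p prs] := poly_interpolation (fun r => Num.sqrt (Num.sqrt r)) rsu.
exists (horner_mx M p).
  (* A polynomial in a symmetric matrix is symmetric, since it commutes with [M]. *)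
  elim/poly_ind: p {prs} => [|p c IH]; first by rewrite rmorph0 trmx0.
  rewrite rmorphD rmorphM/= horner_mx_X horner_mx_C linearD/= tr_scalar_mx.
  congr (_ + _); rewrite -[X in X^T]/(_ *m M) trmx_mul IH MT.
  exact: comm_mx_horner.
have -> : horner_mx M p *m horner_mx M p *m (horner_mx M p *m horner_mx M p) =
    horner_mx M (p * p * (p * p)) by rewrite !rmorphM.
rewrite -[RHS](horner_mx_X M).
(* The minimal polynomial has simple roots, so it divides [p^4 - X] as soon as [p^4 - X] vanishes at
   each of them. *)
apply/eqP; rewrite -subr_eq0 -rmorphB -dvd_mxminpoly pE.
apply: uniq_roots_dvdp; last by rewrite uniq_rootsE.
apply/allP => r rrs; apply/rootP; rewrite !(hornerD, hornerN, hornerM, hornerX) prs//.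
have r0 : 0 <= r.
  by apply: M0; rewrite eigenvalue_root_min pE root_prod_XsubC.
by rewrite -!expr2 !sqr_sqrtr ?sqrtr_ge0// subrr.
Qed.

(** * Quadratic forms, square roots, largest eigenvalue and trace *)

Section QuadraticForms.
Context {R : realType}.
Implicit Types n p : nat.

Lemma mulmx_tr_self_ge0 n (v : 'cV[R]_n) : 0 <= (v^T *m v) 0 0.
Proof. by rewrite mxE sumr_ge0// => i _; rewrite mxE -expr2 sqr_ge0. Qed.

Lemma mulmx_tr_self_eq0 n (v : 'cV[R]_n) : (v^T *m v) 0 0 = 0 -> v = 0.
Proof.
rewrite mxE => /eqP; rewrite psumr_eq0 => [/allP v0|i _]; last first.
  by rewrite mxE -expr2 sqr_ge0.
apply/matrixP => i j; rewrite ord1 [RHS]mxE; apply/eqP.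
by have := v0 i (mem_index_enum _); rewrite /= mxE -expr2 sqrf_eq0.
Qed.

Lemma possemidef_gram n p (K : 'M[R]_(p, n)) : possemidefmx (K^T *m K).
Proof.
split=> [|v]; first by rewrite trmx_mul trmxK.
by have := mulmx_tr_self_ge0 (K *m v); rewrite trmx_mul !mulmxA.
Qed.

Lemma symmetric_possemidef n (M : 'M[R]_n) : M^T = M ->
  (forall a, eigenvalue M a -> 0 <= a) -> possemidefmx M.
Proof.
move=> MT /(symmetric_fourth_root MT)[Q QT <-].
by have := possemidef_gram (Q *m Q); rewrite trmx_mul QT.
Qed.

Lemma sqrtmxP n (M : 'M[R]_n) : possemidefmx M ->
  possemidefmx (sqrtmx M) /\ sqrtmx M *m sqrtmx M = M.
Proof.
move=> [MT M0]; rewrite /sqrtmx; set E := [set _ | _].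
suff /(xgetPex 0) : exists S, E S by [].
have [|Q QT QE] := symmetric_fourth_root MT.
  (* Eigenvectors are row vectors; the form at [v^T] equals [a] times the squared norm of [v]. *)
  move=> a /eigenvalueP[v vM vN0].
  have := M0 v^T; rewrite trmxK vM -scalemxAl mxE pmulr_lge0//.
  rewrite -{1}[v]trmxK lt_neqAle mulmx_tr_self_ge0 andbT eq_sym.
  apply: contra vN0 => /eqP /mulmx_tr_self_eq0 /(congr1 trmx).
  by rewrite trmxK trmx0 => ->.
by exists (Q *m Q); split=> //; have := possemidef_gram Q; rewrite QT.
Qed.

Lemma lambda_maxP n (M : 'M[R]_n.+1) : M^T = M ->
  forall a, eigenvalue M a -> a <= lambda_max M.
Proof.
move=> MT a Ma.
have [rs rsu pE] := mxminpoly_symmetric MT.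
have eigE b : eigenvalue M b = (b \in rs).
  by rewrite eigenvalue_root_min pE root_prod_XsubC.
rewrite /lambda_max; set E := [set _ | _].
suff /(xgetPex 0)[_] : exists b, E b by exact.
(* The maximum starts from the given eigenvalue [a], so its value is again an element of [rs]. *)
exists (\big[Num.max/a]_(r <- rs) r); split.
  rewrite eigE; move: Ma; rewrite eigE => ars.
  suff: forall s, \big[Num.max/a]_(r <- s) r \in a :: s.
    by move=> /(_ rs); rewrite inE => /predU1P[->|].
  elim=> [|x s IH]; first by rewrite big_nil mem_head.
  rewrite big_cons; case: ltP => _; last by rewrite !inE eqxx orbT.
  by move: IH; rewrite !inE => /orP[->//|->]; rewrite !orbT.
by move=> b; rewrite eigE => brs; apply: le_bigmax_seq.
Qed.

(** If [a] is an eigenvalue of [b I - M], then [b - a] is one of [M], whence [a >= 0]; so [b I - M]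
    is positive semidefinite. *)
Lemma lambda_max_quadratic_form n (M : 'M[R]_n) b : M^T = M ->
  lambda_max M <= b ->
  forall v : 'cV_n, (v^T *m M *m v) 0 0 <= b * (v^T *m v) 0 0.
Proof.
(* In size 0 both forms are empty sums, whatever the default value of [lambda_max]. *)
case: n M => [|n] M MT Mb v; first by rewrite !mxE !big_ord0 mulr0.
have [||_ /(_ v)] := @symmetric_possemidef _ (b%:M - M).
- by rewrite linearB/= tr_scalar_mx MT.
- move=> a /eigenvalueP[u uM uN0].
  have /(lambda_maxP MT) : eigenvalue M (b - a).
    apply/eigenvalueP; exists u => //; rewrite scalerBl -uM mulmxBr.
    by rewrite mul_mx_scalar subKr.
  by move=> /le_trans/(_ Mb); rewrite gerBl.
by rewrite mulmxBr mul_mx_scalar mulmxBl -scalemxAl !mxE subr_ge0.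
Qed.

Lemma mxtrace_possemidef n (M : 'M[R]_n) : possemidefmx M ->
  0 <= \tr M ?= iff (M == 0).
Proof.
move=> [MT M0].
(* This is the form at [e_i + t e_j]. Once the diagonal is zero, [t = 1] and [t = -1] force
   [M i j = 0]. *)
have quadE i j (t : R) : 0 <= M i i + t * M i j *+ 2 + t ^+ 2 * M j j.
  have := M0 (delta_mx i 0 + t *: delta_mx j 0).
  rewrite (linearD trmx)/= !linearZ/= !trmx_delta !mulmxDl !mulmxDr.
  rewrite -!scalemxAl -!scalemxAr -!rowE -!colE !mxE.
  have -> : M j i = M i j by rewrite -{1}MT mxE.
  by congr (_ <= _); ring.
have Mii i : 0 <= M i i by have := quadE i i 0; lra.
split; first exact: sumr_ge0.
rewrite eq_sym psumr_eq0//; apply/allP/eqP => [tr0|->]; last first.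
  by move=> i _; rewrite mxE eqxx.
have Mii0 i : M i i = 0 by exact/eqP/tr0/mem_index_enum.
apply/matrixP => i j; rewrite [RHS]mxE.
have := quadE i j 1; have := quadE i j (-1); rewrite !Mii0; lra.
Qed.

Lemma posdef_unitmx n (M : 'M[R]_n) : posdefmx M -> M \in unitmx.
Proof.
move=> [MT M0]; rewrite -row_free_unit -kermx_eq0.
apply/eqP/row_matrixP => i; rewrite row0; apply/eqP/contraT => uN0.
have /M0 : (row i (kermx M))^T != 0.
  by apply: contra uN0 => /eqP/(congr1 trmx); rewrite trmxK trmx0 => ->.
by rewrite trmxK -row_mul mulmx_ker row0 mul0mx mxE ltxx.
Qed.

Lemma posdef_possemidef n (M : 'M[R]_n) : posdefmx M -> possemidefmx M.
Proof.
move=> [MT M0]; split=> // v; have [->|/M0/ltW//] := eqVneq v 0.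
by rewrite mulmx0 mxE.
Qed.

(** The value at [v] is that of the form of [W] at [W^-1 v]. *)
Lemma posdef_invmx_ge0 n (W : 'M[R]_n) (v : 'cV_n) : posdefmx W ->
  0 <= (v^T *m invmx W *m v) 0 0.
Proof.
move=> Wp; have Wu := posdef_unitmx Wp; have [WT W0] := posdef_possemidef Wp.
have := W0 (invmx W *m v).
by rewrite trmx_mul trmx_inv WT -!mulmxA (mulmxA W) mulmxV// mul1mx.
Qed.

(** * The feasible set and its element of least trace *)

Lemma feasible_gram n p (K : 'M[R]_(p, n)) (W : 'M[R]_p) (k : R) : 0 < k ->
  posdefmx W -> lambda_max (K^T *m invmx W *m K) <= 1 / k ->
  possemidefmx (W - k *: (K *m K^T)).
Proof.
move=> k0 Wp Wl; have Wu := posdef_unitmx Wp; have [WT W0] := posdef_possemidef Wp.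
have sW : (invmx W)^T = invmx W by rewrite trmx_inv WT.
split=> [|u]; first by rewrite linearB linearZ/= trmx_mul trmxK WT.
have addE (X Y : 'M[R]_1) : (X - Y) 0 0 = X 0 0 - Y 0 0 by rewrite !mxE.
have scaleE c (X : 'M[R]_1) : (c *: X) 0 0 = c * X 0 0 by rewrite !mxE.
have -> : (u^T *m (W - k *: (K *m K^T)) *m u) 0 0 =
    (u^T *m (W *m u)) 0 0 - k * (u^T *m (K *m K^T *m u)) 0 0.
  by rewrite mulmxBr mulmxBl -scalemxAr -scalemxAl addE scaleE !mulmxA.
have sM : (K^T *m invmx W *m K)^T = K^T *m invmx W *m K.
  by rewrite !trmx_mul trmxK sW mulmxA.
have := lambda_max_quadratic_form sM Wl (K^T *m u).
have := posdef_invmx_ge0 (K *m K^T *m u - k^-1 *: (W *m u)) Wp.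
set g := K *m K^T *m u.
have WiW : invmx W *m (W *m u) = u by rewrite mulmxA mulVmx// mul1mx.
have -> : ((K^T *m u)^T *m (K^T *m invmx W *m K) *m (K^T *m u)) 0 0 =
    (g^T *m invmx W *m g) 0 0 by rewrite /g !trmx_mul trmxK !mulmxA.
have -> : ((K^T *m u)^T *m (K^T *m u)) 0 0 = (u^T *m g) 0 0.
  by rewrite /g trmx_mul trmxK !mulmxA.
rewrite [(_ - _)^T]linearB/= [(_ *: _)^T]linearZ/= [(W *m u)^T]trmx_mul WT.
rewrite !mulmxBl !mulmxBr -!scalemxAl -!scalemxAr.
rewrite -(mulmxA _ (invmx W) (W *m u)) WiW.
rewrite -(mulmxA u^T W) mulmxV// mulmx1.
have -> : g^T *m u = u^T *m g by rewrite /g !trmx_mul trmxK !mulmxA.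
rewrite !(addE, scaleE) div1r.
(* With [x = g^T W^-1 g], [a = u^T g] and [w = u^T W u], the hypotheses read
   [x - 2 a / k + w / k^2 >= 0] and [x <= a / k]; eliminating [x] gives [k a <= w]. *)
move: (_ 0 0) ((u^T *m g) 0 0) ((u^T *m (W *m u)) 0 0) => x a w.
have kV0 : 0 < k^-1 by rewrite invr_gt0.
move=> xaw xa.
have : 0 <= k^-1 * (k^-1 * w - a) by lra.
by rewrite pmulr_rge0// subr_ge0 ler_pdivlMl// subr_ge0.
Qed.

Lemma posdef_gram n p (K : 'M[R]_(p, n)) : row_free K -> posdefmx (K *m K^T).
Proof.
move=> Kf; split=> [|v vN0]; first by rewrite trmx_mul trmxK.
rewrite mulmxA -mulmxA -[X in X *m _]trmxK trmx_mul trmxK.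
rewrite lt_neqAle mulmx_tr_self_ge0 andbT eq_sym.
apply: contra vN0 => /eqP/mulmx_tr_self_eq0/(congr1 trmx).
rewrite trmx_mul trmxK trmx0 => /eqP; rewrite mulmx_free_eq0// => /eqP vT.
by rewrite -[v]trmxK vT trmx0.
Qed.

Lemma posdefmxZ n (M : 'M[R]_n) (k : R) : 0 < k -> posdefmx M -> posdefmx (k *: M).
Proof.
move=> k0 [MT M0]; split=> [|v /M0 Mv]; first by rewrite linearZ/= MT.
by rewrite -scalemxAr -scalemxAl mxE mulr_gt0.
Qed.

Lemma feasible_optimum n p (K : 'M[R]_(p, n)) (k : R) : 0 < k -> row_free K ->
  lambda_max (K^T *m invmx (k *: (K *m K^T)) *m K) <= 1 / k.
Proof.
move=> k0 Kf; have Gu := posdef_unitmx (posdef_gram Kf).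
rewrite invmxZ; last by rewrite unitmxZ// unitfE gt_eqF.
rewrite -scalemxAr -scalemxAl div1r.
set P := K^T *m _ *m K.
have PP : P *m P = P.
  by rewrite /P -!mulmxA (mulmxA K) mulKmx.
rewrite /lambda_max; case: xgetP => [a _ [/eigenvalueP[v vP vN0] _]|_].
  have vPE : v *m P = (k * a) *: v.
    by rewrite -scalerA -vP -scalemxAr scalerA mulfV ?scale1r// gt_eqF.
  (* The matrix is [k^-1 P] with [P] idempotent, so [k a] is 0 or 1 for each eigenvalue [a]. *)
  have /eqP : ((k * a) * (k * a - 1)) *: v = 0.
    rewrite mulrBr mulr1 scalerBl -scalerA -vPE scalemxAl -vPE -mulmxA PP.
    by rewrite subrr.
  rewrite scaler_eq0 (negPf vN0) orbF mulf_eq0 subr_eq0 => /orP[] /eqP ka.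
    by rewrite -(ler_pM2l k0) ka mulr_ge0// ?invr_ge0 ltW.
  by rewrite -(ler_pM2l k0) ka mulfV// gt_eqF.
(* Here [lambda_max] takes its default value 0. *)
by rewrite invr_ge0 ltW.
Qed.

Lemma minimizers_trace n p (N : 'M[R]_(p, n)) (Sigma : 'M[R]_n) (k : R) : 0 < k ->
  posdefmx Sigma -> row_free N ->
  minimizers (fun W : 'M[R]_p => \tr W) (feasible N Sigma (1 / k)) =
  [set k *: (N *m Sigma *m N^T)].
Proof.
move=> k0 Sp Nf.
have [[ST S0] SS] := sqrtmxP (posdef_possemidef Sp).
set S := sqrtmx Sigma in ST S0 SS.
have Su : S \in unitmx.
  by have := posdef_unitmx Sp; rewrite -SS unitmx_mul => /andP[].
pose K := N *m S.
have Kf : row_free K by rewrite /K /row_free mxrankMfree ?row_free_unit.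
have KE : N *m Sigma *m N^T = K *m K^T by rewrite /K trmx_mul ST -SS !mulmxA.
have feasE W : feasible N Sigma (1 / k) W <->
    posdefmx W /\ lambda_max (K^T *m invmx W *m K) <= 1 / k.
  by rewrite /feasible/= -/S /K trmx_mul ST !mulmxA.
rewrite KE; set W0 := k *: _.
have W0f : feasible N Sigma (1 / k) W0.
  by apply/feasE; split; [exact/posdefmxZ/posdef_gram|exact: feasible_optimum].
(* Nonnegativity of the trace of [W - W0], with its equality case, gives both minimality and
   uniqueness. *)
have leW W : feasible N Sigma (1 / k) W -> \tr W0 <= \tr W ?= iff (W - W0 == 0).
  move=> /feasE[Wp Wl].
  have := mxtrace_possemidef (feasible_gram k0 Wp Wl).
  by rewrite linearB/= /Order.leif subr_ge0 [0 == _]eq_sym subr_eq0 [\tr W == _]eq_sym.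
apply/seteqP; split=> W /=.
  move=> [Wf /(_ _ W0f) WW0]; apply/eqP; rewrite -subr_eq0 -(leW _ Wf).
  by rewrite eq_le WW0 andbT (leW _ Wf).
by move=> ->; split=> // V /leW [].
Qed.

End QuadraticForms.

(** * The Gamma integral and the chi-square distribution *)

Section GammaIntegral.
Context {R : realType}.
Local Notation mu := (@lebesgue_measure R).
Implicit Types s a x y : R.

(** Monotone convergence. It reduces integrals over the open half-line to closed ones away from 0,
    where the integrands are continuous. *)
Lemma cvg_integral_itvcy (f : R -> R) a : 0 < a ->
  measurable_fun (`]0, +oo[ : set R) f -> (forall x, 0 < x -> 0 <= f x) ->
  (\int[mu]_(x in `[(a / k.+1%:R)%R, +oo[) (f x)%:E @[k --> \oo] -->
   \int[mu]_(x in `]0%R, +oo[) (f x)%:E)%E.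
Proof.
move=> a0 mf f0.
have ak0 k : 0 < a / k.+1%:R by rewrite divr_gt0.
have sub k : `[a / k.+1%:R, +oo[ `<=` (`]0, +oo[ : set R).
  by move=> x /=; rewrite !in_itv/= !andbT; exact: lt_le_trans.
have -> : `]0, +oo[%classic = \bigcup_k `[a / k.+1%:R, +oo[%classic.
  apply/seteqP; split=> [x /=|x [k _ /sub//]].
  rewrite in_itv/= andbT => x0; exists (Num.truncn (a / x)) => //=.
  by rewrite in_itv/= andbT ler_pdivrMr// mulrC -ler_pdivrMr// ltW// truncnS_gt.
apply: ge0_nondecreasing_set_cvg_integral => //.
- apply/nondecreasing_seqP => k; apply/subsetPset => x /=.
  rewrite !in_itv/= !andbT; apply: le_trans.
  by rewrite ler_pM2l// lef_pV2 ?posrE// ler_nat.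
- move=> k; apply/measurable_EFinP; exact: measurable_funS mf.
- by move=> k x /sub/=; rewrite in_itv/= andbT lee_fin => /f0.
Qed.

(** For [y >= 1], [y^s] is at most [y^(n+1)] with [n] the integer part of [|s|], and
    [y^(n+1) / (n+1)!] is a term of the exponential series. *)
Lemma powR_le_expR s : exists2 C : R, 0 < C & forall y, 1 <= y -> y `^ s <= C * expR y.
Proof.
pose n := Num.truncn `|s|; exists (n.+1`!%:R) => [|y y1]; first by rewrite ltr0n fact_gt0.
have y0 : 0 <= y by apply: le_trans y1.
apply: (@le_trans _ _ (y ^+ n.+1)).
  rewrite -powR_mulrn//; apply: ler_powR => //.
  by apply: le_trans (ler_norm s) _; rewrite ltW// truncnS_gt.
rewrite mulrC -ler_pdivrMr ?ltr0n ?fact_gt0//.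
by apply: le_trans (expR_ge1Dxn n y0); rewrite lerDr.
Qed.

Definition gamma_integrand s x : R := x `^ (s - 1) * expR (- x).

Lemma gamma_integrand_ge0 s x : 0 <= gamma_integrand s x.
Proof. by rewrite mulr_ge0 ?powR_ge0 ?expR_ge0. Qed.

Lemma continuous_powRl s x : 0 < x -> {for x, continuous (fun y => y `^ s)}.
Proof.
move=> x0; apply/differentiable_continuous/derivable1_diffP.
by apply: derivable_powR; rewrite in_itv/= x0.
Qed.

Lemma measurable_gamma_integrand s D : measurable_fun D (gamma_integrand s).
Proof.
apply: measurable_funTS; apply: measurable_funM => //.
by apply: measurableT_comp => //; exact: measurableT_comp.
Qed.

(* [u x = x / (1 + x)]; since [u^s / s] has derivative [u^(s-1) / (1+x)^2], which
   dominates the Gamma integrand up to a constant, it gives integrability both at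
   0 and at +oo. *)
Let u x : R := 1 - (1 + x)^-1.

Let is_derive_u x : 0 < x -> is_derive x 1 u ((1 + x) ^- 2).
Proof.
move=> x0; have x1 : 1 + x != 0 by rewrite gt_eqF// addr_gt0.
apply: is_derive_eq.
by rewrite !add0r mul1r scaleNr opprK /GRing.scale/= mulr1.
Qed.

Let u_gt0 x : 0 < x -> 0 < u x.
Proof. by move=> x0; rewrite subr_gt0 invf_lt1 ?ltrDl// addr_gt0. Qed.

Let cvg_u : u x @[x --> +oo] --> (1 : R).
Proof.
rewrite -[X in _ --> X]subr0; apply: cvgB; first exact: cvg_cst.
have u0 : \forall x \near +oo, 0 < 1 + x :> R.
  by near=> x; rewrite addr_gt0//; near: x; exact: nbhs_pinfty_gt.
apply/(gtr0_cvgV0 u0)/cvgryPge => A; near=> x; rewrite ler_wpDl//.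
Unshelve. all: by end_near. Qed.

Let is_derive_u_powR s x : 0 < s -> 0 < x ->
  is_derive x 1 (fun y => s^-1 * u y `^ s) (u x `^ (s - 1) * (1 + x) ^- 2).
Proof.
move=> s0 x0.
have uD := is_derive_u x0.
have pD := is_derive1_powR s (u_gt0 x0).
have upD := is_derive1_comp pD uD.
apply: is_derive_eq (is_deriveZ s^-1 upD) _.
by rewrite /GRing.scale/= !mulrA mulVf ?mul1r// gt_eqF.
Qed.

Let w s x : R := u x `^ (s - 1) * (1 + x) ^- 2.

Let w_ge0 s x : 0 <= w s x.
Proof. by rewrite mulr_ge0 ?powR_ge0// invr_ge0 sqr_ge0. Qed.

Let continuous_w s x : 0 < x -> {for x, continuous (w s)}.
Proof.
move=> x0; have x1 : 1 + x != 0 by rewrite gt_eqF// addr_gt0.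
apply: cvgM.
  apply: (@continuous_comp _ _ _ u (fun y => y `^ (s - 1))).
    apply/differentiable_continuous/derivable1_diffP.
    by have [] := is_derive_u x0.
  exact/continuous_powRl/u_gt0.
apply: cvgV; first by rewrite expf_neq0.
by apply: cvgM; apply: cvgD => //; exact: cvg_cst.
Qed.

Let continuous_itvcy_w s a : 0 < a -> {within `[a, +oo[, continuous (w s)}.
Proof.
move=> a0; apply: continuous_in_subspaceT => x; rewrite inE/= in_itv/= andbT.
by move=> /(lt_le_trans a0); exact: continuous_w.
Qed.

Let integral_w s a : 0 < s -> 0 < a ->
  (\int[mu]_(x in `[a, +oo[) (w s x)%:E <= s^-1%:E)%E.
Proof.
move=> s0 a0.
have dF x : a < x -> is_derive x 1 (fun y => s^-1 * u y `^ s) (w s x).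
  by move=> ax; apply: is_derive_u_powR => //; exact: lt_trans ax.
(* The primitive tends to [s^-1] because [u] tends to 1, and its value at [a] is nonnegative. *)
rewrite (@ge0_continuous_FTC2y _ _ (fun y => s^-1 * u y `^ s) a s^-1)//.
- by rewrite -EFinB lee_fin lerBlDr lerDl mulr_ge0 ?powR_ge0// invr_ge0 ltW.
- exact: continuous_itvcy_w.
- rewrite -[X in _ --> X]mulr1; apply: cvgM; first exact: cvg_cst.
  rewrite [X in _ --> X](_ : 1 = 1 `^ s); last by rewrite powR1.
  apply: (@continuous_cvg _ _ _ _ _ u (fun y => y `^ s)) => //.
  exact: continuous_powRl.
- by move=> x /dF[].
- apply: cvg_at_right_filter.
  by have [/derivable1_diffP/differentiable_continuous] := is_derive_u_powR s0 a0.
- by move=> x; rewrite in_itv/= andbT => /dF dFx; rewrite derive1E derive_val.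
Qed.

Lemma integral_gamma_integrand_lty s : 0 < s ->
  (\int[mu]_(x in `]0%R, +oo[) (gamma_integrand s x)%:E < +oo)%E.
Proof.
move=> s0; have [C C0 CP] := powR_le_expR (s + 1).
suff : (\int[mu]_(x in `]0%R, +oo[) (gamma_integrand s x)%:E <=
    (C * expR 1)%:E * s^-1%:E)%E by move=> /le_lt_trans; apply; rewrite ltry.
have h := cvg_integral_itvcy ltr01 (@measurable_gamma_integrand s _)
  (fun x _ => gamma_integrand_ge0 s x).
apply: (cvge_le _ h); apply: nearW => k.
set a := (1 / _)%R; have a0 : 0 < a by rewrite divr_gt0.
have C1 : 0 <= C * expR 1 by rewrite mulr_ge0 ?expR_ge0// ltW.
have mw : measurable_fun (`[a, +oo[ : set R) (w s).
  apply: subspace_continuous_measurable_fun => //; exact: continuous_itvcy_w.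
apply: (@le_trans _ _ ((C * expR 1)%:E * \int[mu]_(x in `[a, +oo[) (w s x)%:E)%E); last first.
  by rewrite lee_pmul2l ?integral_w// lte_fin mulr_gt0 ?expR_gt0.
rewrite -ge0_integralZl//; last 2 first.
- exact/measurable_EFinP.
- by move=> x _; rewrite lee_fin.
apply: ge0_le_integral => //.
- by move=> x _; rewrite lee_fin gamma_integrand_ge0.
- by apply/measurable_EFinP; exact: measurable_gamma_integrand.
- apply/measurable_EFinP; exact: measurable_funM.
move=> x /=; rewrite in_itv/= andbT => ax; rewrite -EFinM lee_fin.
have x0 : 0 < x by exact: lt_le_trans ax.
have x1 : 0 < 1 + x by rewrite addr_gt0.
(* Since [x = u x * (1 + x)], the integrand is [w s x] times [(1 + x)^(s + 1) e^(-x)], and the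
   latter is at most [C e] by the choice of [C]. *)
have -> : gamma_integrand s x = u x `^ (s - 1) * (1 + x) ^- 2 *
    ((1 + x) `^ (s + 1) * expR (- x)).
  have xE : x = u x * (1 + x) by rewrite /u mulrBl mul1r mulVf ?gt_eqF// addrC addKr.
  rewrite /gamma_integrand {1}xE powRM ?ltW// ?u_gt0//.
  have -> : s + 1 = s - 1 + 2%:R by ring.
  rewrite (@powRD _ _ (s - 1) 2%:R) ?(gt_eqF x1) ?implybT// (@powR_mulrn _ _ 2) ?ltW//.
  by field; rewrite gt_eqF.
rewrite mulrC; apply: ler_wpM2r; first exact: w_ge0.
have /CP : 1 <= 1 + x by rewrite lerDl ltW.
by rewrite expRD expRN mulrA ler_pdivrMr// expR_gt0.
Qed.

End GammaIntegral.

(** * Total mass of the chi-square density *)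

Section ChiSquare.
Context {R : realType}.
Local Notation mu := (@lebesgue_measure R).
Implicit Types s x : R.

Lemma integral_gamma_integrand_scale s : 0 < s ->
  (\int[mu]_(x in `]0%R, +oo[) (x `^ (s - 1) * expR (- x / 2))%:E =
   (2 `^ s)%:E * \int[mu]_(x in `]0%R, +oo[) (gamma_integrand s x)%:E)%E.
Proof.
move=> s0; pose G x : R := x `^ (s - 1) * expR (- x / 2).
have mG D : measurable_fun D G.
  apply: measurable_funTS; apply: measurable_funM => //.
  by apply: measurableT_comp => //; apply: measurable_funM.
have G0 x : 0 <= G x by rewrite mulr_ge0 ?powR_ge0 ?expR_ge0.
have cG x : 0 < x -> {for x, continuous G}.
  move=> x0; apply: cvgM; first exact: continuous_powRl.
  apply: continuous_comp; last exact: continuous_expR.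
  by apply: cvgM; [exact: cvgN|exact: cvg_cst].
(* The truncations start at [2 / (k+1)] here and at [1 / (k+1)] below, so that [x = 2 y] matches
   them term by term. *)
have hG := cvg_integral_itvcy (@ltr0n _ 2) (mG _) (fun x _ => G0 x).
have hg := cvg_integral_itvcy ltr01 (@measurable_gamma_integrand _ s _)
  (fun x _ => gamma_integrand_ge0 s x).
rewrite -(cvg_lim _ hG)// -(cvg_lim _ (cvgeZl _ hg))//.
congr (limn _); apply/funext => k /=.
set a := (1 / _)%R; have a0 : 0 < a by rewrite divr_gt0.
pose F x : R := 2 * x.
have dF x : is_derive x 1 F 2.
  by apply: is_derive_eq; rewrite /GRing.scale/= mulr1.
have dFE : F^`()%classic = cst 2 by apply/funext => x; rewrite derive1E derive_val.
have cF x : {for x, continuous F}.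
  by apply/differentiable_continuous/derivable1_diffP; have [] := dF x.
have -> : 2 / k.+1%:R = F a by rewrite /F /a mul1r.
rewrite (@increasing_ge0_integration_by_substitutiony _ F G a)//; last first.
- apply: continuous_in_subspaceT => x; rewrite inE/= in_itv/= andbT => ax.
  by apply: cG; apply: lt_le_trans ax; rewrite mulr_gt0.
- apply/cvgryPge => A; near=> x; rewrite -ler_pdivrMl//.
- by split=> [x _|]; [have [] := dF x|exact/cvg_at_right_filter/cF].
- by rewrite dFE; exact: is_cvg_cst.
- by rewrite dFE; exact: is_cvg_cst.
- by rewrite dFE => x _; exact: cvg_cst.
- by move=> x y _ _ xy; rewrite ltr_pM2l.
rewrite -ge0_integralZl//; last 2 first.
- by apply/measurable_EFinP; exact: measurable_gamma_integrand.
- by move=> x _; rewrite lee_fin gamma_integrand_ge0.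
apply: eq_integral => x; rewrite inE/= in_itv/= andbT => ax.
have x0 : 0 < x by exact: lt_le_trans ax.
rewrite -EFinM dFE /G /F /gamma_integrand/=; congr EFin.
transitivity ((2 * x) `^ (s - 1) * expR (- (2 * x) / 2) * 2) => //.
have -> : - (2 * x) / 2 = - x by field.
by rewrite powRM ?ltW// -(@mulr_powRB1 _ 2 s)//; ring.
Unshelve. all: by end_near. Qed.

(** [Gamma_fun] is the real part of an extended integral, so identifying the two requires
    finiteness. *)
Lemma Gamma_funE s : 0 < s ->
  (\int[mu]_(x in `]0%R, +oo[) (gamma_integrand s x)%:E = (Gamma_fun s)%:E)%E.
Proof.
move=> s0; rewrite fineK// ge0_fin_numE; first exact: integral_gamma_integrand_lty.
by apply: integral_ge0 => x _; rewrite lee_fin gamma_integrand_ge0.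
Qed.

Lemma Gamma_fun_gt0 s : 0 < s -> 0 < Gamma_fun s.
Proof.
move=> s0; rewrite -lte_fin -Gamma_funE//.
(* On [[1, 2]], [x^(s-1) >= x^-1 >= 1/2] and [e^(-x) >= e^(-2)]. *)
pose c : R := 2^-1 * expR (- 2).
have c0 : 0 < c by rewrite mulr_gt0 ?expR_gt0.
have mg D : measurable_fun D (fun x : R => (gamma_integrand s x)%:E).
  by apply/measurable_EFinP; exact: measurable_gamma_integrand.
apply: (@lt_le_trans _ _ (\int[mu]_(x in `[1%R, 2%R]) (cst c%:E x))%E).
  rewrite integral_cst//= lebesgue_measure_itv/= lte_fin ltr1n/= -EFinB -EFinM.
  by rewrite lte_fin mulr_gt0// subr_gt0 ltr1n.
apply: (@le_trans _ _ (\int[mu]_(x in `[1%R, 2%R]) (gamma_integrand s x)%:E)%E).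
  apply: ge0_le_integral => //.
  - by move=> x _; rewrite lee_fin ltW.
  - exact: mg.
  move=> x /=; rewrite in_itv/= => /andP[x1 x2]; rewrite lee_fin.
  have x0 : 0 < x by exact: lt_le_trans x1.
  apply: ler_pM; rewrite ?expR_ge0//; last by rewrite ler_expR lerN2.
  apply: (@le_trans _ _ (x `^ (- 1))).
    by rewrite powR_inv1 ?(ltW x0)// lef_pV2 ?posrE.
  by rewrite ler_powR// lerDr ltW.
apply: ge0_subset_integral => //; first exact: mg.
  by move=> x _; rewrite lee_fin gamma_integrand_ge0.
move=> x /=; rewrite !in_itv/= andbT => /andP[x1 _].
exact: lt_le_trans x1.
Qed.

Lemma chi2_density_ge0 k x : (0 < k)%N -> 0 <= chi2_density k x :> R.
Proof.
move=> k0; rewrite /chi2_density mulr_ge0 ?expR_ge0// mulr_ge0 ?powR_ge0//.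
by rewrite invr_ge0 mulr_ge0 ?powR_ge0// ltW// Gamma_fun_gt0// divr_gt0 ?ltr0n.
Qed.

Lemma measurable_chi2_density k D : measurable_fun D (@chi2_density R k).
Proof.
apply: measurable_funTS; apply: measurable_funM; first exact: measurable_funM.
by apply: measurableT_comp => //; apply: measurable_funM.
Qed.

Lemma integral_chi2_density k : (0 < k)%N ->
  (\int[mu]_(x in `]0%R, +oo[) (chi2_density k x)%:E = 1)%E.
Proof.
move=> k0; have s0 : 0 < k%:R / 2 :> R by rewrite divr_gt0 ?ltr0n.
have G0 := Gamma_fun_gt0 s0.
have P0 : 0 < 2 `^ (k%:R / 2) :> R by rewrite powR_gt0.
under eq_integral do rewrite /chi2_density -mulrA EFinM.
rewrite ge0_integralZl//.
- rewrite integral_gamma_integrand_scale// Gamma_funE// -!EFinM mulVf//.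
  by rewrite mulf_neq0// gt_eqF.
- apply/measurable_EFinP/measurable_funTS; apply: measurable_funM => //.
  by apply: measurableT_comp => //; apply: measurable_funM.
- by move=> x _; rewrite lee_fin mulr_ge0 ?powR_ge0 ?expR_ge0.
- by rewrite lee_fin invr_ge0 mulr_ge0// ltW.
Qed.

(** * Quantiles and positivity of the privacy constants *)

Lemma distribution_surjective (p : R -> R) (gamma : R) :
  measurable_fun setT p -> (forall x, 0 <= p x) ->
  (\int[mu]_(x in `]0%R, +oo[) (p x)%:E = 1)%E -> 0 < gamma < 1 ->
  exists2 x, 0 < x & gamma = \int[mu]_(t in `]0, x[) p t.
Proof.
move=> mp p0 p1 /andP[g0 g1].
have mpD D : measurable_fun D (EFin \o p).
  by apply/measurable_EFinP; exact: measurable_funTS.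
have ip b : mu.-integrable `[0, b] (EFin \o p).
  apply/integrableP; split; first exact: mpD.
  under eq_integral do rewrite gee0_abs ?lee_fin//=.
  (* Removing the null endpoint 0 lets the total mass 1 bound the integral. *)
  rewrite -integral_itv_obnd_cbnd; last exact: mpD.
  apply: (@le_lt_trans _ _ 1%E); rewrite ?ltry// -p1.
  apply: ge0_subset_integral => //; first exact: mpD.
    by move=> x _; rewrite lee_fin.
  by move=> x /=; rewrite !in_itv/= andbT => /andP[].
pose H x := \int[mu]_(t in `[0, x]) p t.
(* [H n] tends to 1, so it exceeds [gamma] for some [n]; the intermediate value theorem then applies
   on [[0, b]]. *)
have [b b0 gb] : exists2 b, 0 <= b & gamma < H b.
  have cvgH : ((H n%:R)%:E @[n --> \oo] --> 1%:E)%E.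
    rewrite -p1 itv_bndy_bigcup_BRight.
    have -> : (fun n => (H n%:R)%:E) = (fun n => \int[mu]_(x in `]0%R, (0 + n%:R)%R]) (p x)%:E)%E.
      apply/funext => n; rewrite add0r integral_itv_obnd_cbnd; last exact: mpD.
      by rewrite /H /Rintegral fineK//; exact: integrable_fin_num.
    apply: ge0_nondecreasing_set_cvg_integral => //.
    - apply/nondecreasing_seqP => k; apply/subsetPset => x.
      by apply: subset_itvl; rewrite bnd_simp lerD2l ler_nat.
    - by move=> n; exact: mpD.
    - by move=> n x _; rewrite lee_fin.
  have [[n gn]|noH] := pselect (exists n, gamma < H n%:R); first by exists n%:R.
  suff : (1%:E <= gamma%:E)%E by rewrite lee_fin leNgt g1.
  apply: (cvge_le _ cvgH); apply: nearW => n; rewrite lee_fin leNgt.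
  by apply/negP => gn; apply: noH; exists n.
have H0 : H 0 = 0 by rewrite /H set_itv1 Rintegral_set1.
have [||x] := @IVT _ H 0 b gamma b0.
- exact: parameterized_integral_continuous.
- by rewrite H0 ge_min ltW//= le_max (ltW gb) orbT.
rewrite in_itv/= => /andP[x0 xb] Hx; exists x.
  rewrite lt_neqAle x0 andbT; apply/eqP => x00.
  by move: g0; rewrite -Hx -x00 H0 ltxx.
have ipS (D : set R) : measurable D -> D `<=` `[0, x] -> mu.-integrable D (EFin \o p).
  by move=> mD Dx; exact: integrableS (ip x).
rewrite -Hx /H Rintegral_itv_bndo_bndc; last first.
  by apply: ipS => // y; apply: subset_itv; rewrite bnd_simp.
rewrite Rintegral_itv_obnd_cbnd//; apply: ipS => // y.
by apply: subset_itv; rewrite bnd_simp.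
Qed.

Lemma c_const_gt0 m (gamma : R) T : (0 < m)%N -> 0 < gamma < 1 ->
  0 < c_const m gamma T.
Proof.
move=> m0 g01; have k0 : (0 < T.+1 * m)%N by rewrite muln_gt0.
have [x x0 xE] := distribution_surjective (@measurable_chi2_density _ setT)
  (fun x => chi2_density_ge0 x k0) (integral_chi2_density k0) g01.
rewrite /c_const; set E := [set _ | _].
suff /(xgetPex 0)[] : exists c, E c by [].
(* The upper limit of integration is [c^2 / 2], so the quantile [x] corresponds to
   [c = sqrt (2 x)]. *)
exists (Num.sqrt (2 * x)); split; first by rewrite sqrtr_gt0 mulr_gt0.
by rewrite sqr_sqrtr ?mulr_ge0 ?(ltW x0)// mulrC mulKf.
Qed.

(** The square root exceeds the absolute value of [Q_inv delta], so the numerator is positive. *)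
Lemma R_fun_gt0 (eps delta : R) : 0 < eps -> 0 < R_fun eps delta.
Proof.
move=> e0; rewrite divr_gt0 ?mulr_gt0//.
rewrite -ltrBlDl sub0r (le_lt_trans (ler_norm _))// normrN -sqrtr_sqr.
by rewrite ltr_sqrt ?ltrDl ?mulr_gt0// ltr_wpDl ?sqr_ge0// mulr_gt0.
Qed.

End ChiSquare.

Theorem theorem10 (R : realType) (n m q T : nat)
  (A : 'M[R]_n) (B : 'M[R]_(n, m)) (C : 'M[R]_(q, n)) (D : 'M[R]_(q, m))
  (Sigma : 'M[R]_(T.+1 * m)) (gamma eps delta : R)
  (hm : (0 < m)%N)
  (hSigma : posdefmx Sigma)
  (hgamma : 0 < gamma < 1)
  (heps : 0 < eps)
  (hdelta : 0 < delta < 1 / 2)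
  (hN : row_free (io_matrix A B C D T)) :
  let N := io_matrix A B C D T in
  let k := c_const m gamma T ^+ 2 * R_fun eps delta ^+ 2 in
  minimizers (fun W : 'M[R]_(T.+1 * q) => \tr W) (feasible N Sigma (1 / k)) =
  [set k *: (N *m Sigma *m N^T)].
Proof.
move=> N k; apply: minimizers_trace => //.
by rewrite /k mulr_gt0// exprn_gt0// ?c_const_gt0// R_fun_gt0.
Qed.
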